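(* Let $\mathcal{F}$ be a convex class of probability distributions on $\mathsf{O}$ and let $T: \mathcal{F} \to \mathbb{R}$ be a max-functional. For $k \in \mathbb{N}$ let $\mathcal{U}_k$ be the set of all $T' \in \mathcal{E}_k(\mathcal{F})$ that are mixture-continuous, have elicitable components, and satisfy $\operatorname{int}(T'(\mathcal{F})) \neq \emptyset$, where $\operatorname{int}$ denotes the interior in $\mathbb{R}^k$; and let $\mathcal{V}_k$ be the set of all $T' \in \mathcal{E}_k(\mathcal{F})$ that are mixture-continuous, have elicitable components, and for which $T'(\mathcal{F})$ is open in $\mathbb{R}^k$. Then the following hold. (a) $T$ has elicitation complexity $\infty$ with respect to $(\mathcal{U}_k)_{k \in \mathbb{N}}$ unless $T(\mathcal{F})$ contains its supremum. (b) $T$ has elicitation complexity $\infty$ with respect to $(\mathcal{V}_k)_{k \in \mathbb{N}}$ unless $T$ is constant.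
   Context: $\mathsf{O} \subseteq \mathbb{R}^d$ is a fixed set (observation domain) equipped with its Borel $\sigma$-algebra. Max-functional: a map $T: \mathcal{F} \to \mathbb{R}$ with $T(\lambda F_1 + (1-\lambda) F_0) = \max(T(F_0), T(F_1))$ for all $F_0, F_1 \in \mathcal{F}$ and $\lambda \in (0,1)$. Elicitability: for a functional $T': \mathcal{F} \to \mathsf{A}' \subseteq \mathbb{R}^k$, a scoring function is a map $S: \mathsf{A}' \times \mathsf{O} \to \mathbb{R}$ such that for every $x \in \mathsf{A}'$ the function $y \mapsto S(x,y)$ is measurable and integrable with respect to every $F \in \mathcal{F}$; write $\bar S(x,F) := \int_{\mathsf{O}} S(x,y)\, dF(y)$. It is strictly $\mathcal{F}$-consistent for $T'$ if for all $x \in \mathsf{A}'$ and $F \in \mathcal{F}$ we have $\bar S(x,F) \ge \bar S(T'(F),F)$, and equality implies $x = T'(F)$. The functional $T'$ is elicitable if there exists a strictly $\mathcal{F}$-consistent scoring function for it. $\mathcal{E}_k(\mathcal{F})$ denotes the set of all $\mathbb{R}^k$-valued elicitable functionals defined on $\mathcal{F}$. A functional $T' = (T'_1, \ldots, T'_k)$ has elicitable components if each real-valued functional $T'_j$ on $\mathcal{F}$ is elicitable. Mixture-continuity: a functional $T': \mathcal{F} \to \mathsf{A}'$ is mixture-continuous if for all $F_0, F_1 \in \mathcal{F}$ such that $\lambda F_1 + (1-\lambda)F_0 \in \mathcal{F}$ for all $\lambda \in [0,1]$, the map $[0,1] \to \mathsf{A}'$, $\lambda \mapsto T'(\lambda F_1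 + (1-\lambda) F_0)$ is continuous. Elicitation complexity: for sets $\mathcal{C}_k \subseteq \mathcal{E}_k(\mathcal{F})$ and a functional $T: \mathcal{F} \to \mathsf{A} \subseteq \mathbb{R}$, the elicitation complexity of $T$ with respect to $(\mathcal{C}_k)_{k \in \mathbb{N}}$ is $$\mathsf{elic}(T) := \min\{ k \in \mathbb{N} \mid \exists\, T' \in \mathcal{C}_k :\ T = f \circ T' \text{ for some } f: T'(\mathcal{F}) \to \mathsf{A} \},$$ and $\mathsf{elic}(T) := \infty$ if no such $k$ exists. The link function $f$ is arbitrary. *)

(* Defs.v *)
From HB Require Import structures.
From mathcomp Require Import all_boot all_order all_algebra.
From mathcomp Require Import all_classical all_reals all_analysis.

Set Implicit Arguments.
Unset Strict Implicit.
Unset Printing Implicit Defensive.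

Import Order.TTheory GRing.Theory Num.Theory.
Import numFieldNormedType.Exports.

Local Open Scope classical_set_scope.
Local Open Scope ring_scope.

(* [measurableType]s are pointed, hence the proof [neO] that the observation
   domain is nonempty; there is no probability measure on an empty domain. *)
Section observation_domain.
Context {X : topologicalType} {O : set X}.
Implicit Types neO : O !=set0.

Definition domain (neO : O !=set0) : Type := set_type O.

HB.instance Definition _ neO := Choice.on (domain neO).

Let domain_point neO : domain neO :=
  let: exist x Ox := cid neO in exist _ x (mem_set Ox).

HB.instance Definition _ neO := isPointed.Build (domain neO) (domain_point neO).

(* [open] refers to the subspace topology of [O]. *)
Definition borel_domain neO :=
  @g_sigma_algebraType (domain neO) (@open (set_type O)).

HB.instance Definition _ neO := Measurable.on (borel_domain neO).

End observation_domain.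

Section mixture.
Context {dY} {Y : measurableType dY} {R : realType}.
Implicit Types (l : {i01 R}) (P Q : probability Y R).

Definition mixture_measure l P1 P0 : set Y -> \bar R :=
  measure_add (mscale l%:num%:nng P1) (mscale (1 - l%:num)%:nng P0).

Lemma mixture_measureE l P1 P0 A :
  mixture_measure l P1 P0 A = (l%:num%:E * P1 A + (1 - l%:num)%:E * P0 A)%E.
Proof. exact: measure_addE. Qed.

HB.instance Definition _ l P1 P0 := Measure.on (mixture_measure l P1 P0).

Let mixture_setT l P1 P0 : mixture_measure l P1 P0 setT = 1%E.
Proof.
by rewrite mixture_measureE !probability_setT !mule1 -EFinD addrC subrK.
Qed.

HB.instance Definition _ l P1 P0 :=
  Measure_isProbability.Build _ _ _ (mixture_measure l P1 P0)
    (mixture_setT l P1 P0).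

Definition mixture l P1 P0 : probability Y R := mixture_measure l P1 P0.

Lemma mixtureE l P1 P0 A :
  mixture l P1 P0 A = (l%:num%:E * P1 A + (1 - l%:num)%:E * P0 A)%E.
Proof. exact: mixture_measureE. Qed.

End mixture.

(* A functional on [F] is represented by a function on all probability
   measures, of which only the values on [F] matter. A [probability] also assigns
   values to non-measurable sets, and two of them are equal only if these values
   agree too. Taking all of them to be 0 picks one representative of each
   distribution, and this choice is preserved by [mixture]. *)
Section elicitation.
Context {dY} {Y : measurableType dY} {R : realType}.
Implicit Types (F : set (probability Y R)) (P : probability Y R).

Definition convex_class F := forall P0 P1 (l : {i01 R}),
  F P0 -> F P1 -> F (mixture l P1 P0).

Definition max_functional F (T : probability Y R -> R) :=
  forall P0 P1 (l : {i01 R}), F P0 -> F P1 -> 0 < l%:num < 1 ->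
    T (mixture l P1 P0) = Num.max (T P0) (T P1).

Definition scoring_function F (V : Type) (A : set V) (S : V -> Y -> R) :=
  forall x, A x -> measurable_fun setT (S x) /\
    forall P, F P -> P.-integrable setT (EFin \o S x).

Definition expected_score (V : Type) (S : V -> Y -> R) (x : V) P : R :=
  \int[P]_y S x y.

Definition strictly_consistent F (V : Type) (A : set V)
    (T : probability Y R -> V) (S : V -> Y -> R) :=
  forall x P, A x -> F P ->
    expected_score S (T P) P <= expected_score S x P /\
    (expected_score S x P = expected_score S (T P) P -> x = T P).

Definition elicitable_on F (V : Type) (A : set V)
    (T : probability Y R -> V) :=
  exists S, scoring_function F A S /\ strictly_consistent F A T S.

(* The codomain [A] is part of a functional [T : F -> A], hence is
   existentially quantified when only [V]-valuedness is prescribed. *)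
Definition elicitable F (V : Type) (T : probability Y R -> V) :=
  exists A : set V, set_fun F A T /\ elicitable_on F A T.

Definition elicitable_functionals F k : set (probability Y R -> 'rV[R]_k) :=
  [set T | elicitable F T].

Definition elicitable_components F k (T : probability Y R -> 'rV[R]_k) :=
  forall j : 'I_k, elicitable F (fun P => T P ord0 j).

(* [0, 1] carries the topology induced by the inclusion into [R]. *)
Definition unit_interval := initial_topology (fun l : {i01 R} => l%:num).

HB.instance Definition _ := Topological.on unit_interval.

Definition mixture_continuous F (V : topologicalType)
    (T : probability Y R -> V) :=
  forall P0 P1, F P0 -> F P1 -> (forall l, F (mixture l P1 P0)) ->
    continuous (fun l : unit_interval => T (mixture l P1 P0)).

Definition linked F (T : probability Y R -> R) k
    (C : set (probability Y R -> 'rV[R]_k)) :=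
  exists T', C T' /\
    exists f : 'rV[R]_k -> R, forall P, F P -> T P = f (T' P).

(* [k = 0] is allowed, where ['rV[R]_0] is a single point; it is attained by
   constant functionals only. *)
Definition elicitation_complexity F
    (C : forall k, set (probability Y R -> 'rV[R]_k))
    (T : probability Y R -> R) : \bar R :=
  match pselect (exists k, `[< linked F T (C k) >]) with
  | left ex_k => (ex_minn ex_k)%:R%:E
  | right _ => +oo%E
  end.

Definition interior_class F k : set (probability Y R -> 'rV[R]_k) :=
  [set T | [/\ elicitable_functionals F T, mixture_continuous F T,
               elicitable_components F T & (T @` F)° !=set0]].

Definition open_class F k : set (probability Y R -> 'rV[R]_k) :=
  [set T | [/\ elicitable_functionals F T, mixture_continuous F T,
               elicitable_components F T & open (T @` F)]].

End elicitation.

(* Main.v *)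
Require Import Defs.
From HB Require Import structures.
From mathcomp Require Import all_boot all_order all_algebra.
From mathcomp Require Import all_classical all_reals all_analysis.
From mathcomp Require Import measurable_realfun ring lra.

Set Implicit Arguments.
Unset Strict Implicit.
Unset Printing Implicit Defensive.

Import Order.TTheory GRing.Theory Num.Theory.
Import numFieldNormedType.Exports.
Local Open Scope classical_set_scope.
Local Open Scope ring_scope.

(** The point is that a max-functional [T] which factors as [f \o T'] through an
    admissible [T'] takes its largest value at every interior point [x] of the
    range of [T']: if [P] is in the class, some mixture [M] giving positive
    weight to [P] has [T' M = x], so that [f x = T M >= T P].  Hence the supremum
    is attained as soon as the range has an interior point, and [T] is constant
    when all the points of the range are interior.

    A mixture [M] through [P] that hits [x] exactly is found without any fixed
    point theorem, because the coordinates of [T'] behave well separately.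
    Elicitable functionals have convex level sets, since the expected score is
    affine in the distribution ([elicitable_level_convex]).  For a continuous
    real function on a segment, convexity of the level sets forces monotonicity,
    so a half line containing the values of a coordinate at both ends of a
    segment contains all of its values in between ([mixture_gt], [mixture_lt]).

    Let [x + s * delta], for [s] a vector of signs, be the corners of a small
    cube inside the range.  For each [s], take a distribution with this value and
    mix into it so little of [P] that every coordinate remains on the side of [x]
    given by [s] ([small_mixture_close]).  Then merge these [2 ^ k] distributions
    in pairs, one coordinate at a time: two of them which differ only in their
    [n]-th sign have, by the intermediate value theorem, a mixture whose [n]-th
    coordinate is that of [x].  Coordinates already equal to those of [x] stay so
    because level sets are convex, and the others stay on their side.  After [k]
    rounds the value is [x] ([max_functional_le_interior_value]).  No mixture
    taken on the way brings [T] below [T P]. *)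

(** * Mixtures of probability measures *)

(** All the components of a probability measure but its underlying function are
    proofs, so proof irrelevance settles the matter. *)
Lemma probability_eq d (Y : measurableType d) (R : realType)
    (P Q : probability Y R) : P =1 Q -> P = Q.
Proof.
move: P Q => [p cp] [q cq] /= pq0.
have pq : p = q by exact: funext.
subst q; congr Probability.Pack.
destruct cp as [a b c e f g h], cq as [a' b' c' e' f' g' h'].
(* The type of [b] depends on [a]. *)
have aa : a = a' by destruct a, a'; f_equal; exact: Prop_irrelevance.
subst a'.
have bb : b = b' by destruct b, b'; f_equal; exact: Prop_irrelevance.
have cc : c = c' by destruct c, c'; f_equal; exact: Prop_irrelevance.
have ee : e = e' by destruct e, e'; f_equal; exact: Prop_irrelevance.
have ff : f = f' by destruct f, f'; f_equal; exact: Prop_irrelevance.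
have gg : g = g' by destruct g, g'; f_equal; exact: Prop_irrelevance.
have hh : h = h' by destruct h, h'; f_equal; exact: Prop_irrelevance.
by subst.
Qed.

Section clamp.
Context {R : realType}.

Let clamp_itv (r : R) : 0 <= Num.max 0 (Num.min r 1) <= 1.
Proof. by rewrite le_max lexx ge_max ler01 ge_min lexx orbT. Qed.

(** The retraction of the line onto the unit interval: it turns functions of the
    mixture weight into functions on all of [R], for which the intermediate value
    theorem is stated. *)
Definition clamp (r : R) : {i01 R} :=
  Itv01 (andP (clamp_itv r)).1 (andP (clamp_itv r)).2.

Lemma clampE (r : R) : 0 <= r <= 1 -> (clamp r)%:num = r.
Proof.
by case/andP => r0 r1; rewrite /clamp/= (min_idPl r1); exact/max_idPr.
Qed.

Lemma clamp0 : (clamp 0)%:num = 0.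
Proof. by rewrite clampE ?lexx ?ler01. Qed.

Lemma clamp1 : (clamp 1)%:num = 1.
Proof. by rewrite clampE ?lexx ?ler01. Qed.

Lemma clamp_continuous : continuous (clamp : R -> @unit_interval R).
Proof.
apply: continuous_comp_initial => r.
apply: (@continuous_max _ _ (cst (0 : R)) (fun x : R => Num.min x 1)).
  exact: cst_continuous.
apply: (@continuous_min _ _ (fun x : R => x) (cst (1 : R))) => //.
exact: cst_continuous.
Qed.

End clamp.

Section mixture_theory.
Context {dY} {Y : measurableType dY} {R : realType}.
Implicit Types (P Q : probability Y R) (l t : {i01 R}).

Lemma mixture_start l P1 P0 : l%:num = 0 -> mixture l P1 P0 = P0.
Proof.
move=> l0; apply: probability_eq => A.
by rewrite mixtureE l0 subr0 mul0e mul1e add0e.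
Qed.

Lemma mixture_end l P1 P0 : l%:num = 1 -> mixture l P1 P0 = P1.
Proof.
move=> l1; apply: probability_eq => A.
by rewrite mixtureE l1 subrr mul0e mul1e adde0.
Qed.

Lemma mixture_of_mixtures t a b l P1 P0 :
  l%:num = t%:num * b%:num + (1 - t%:num) * a%:num ->
  mixture l P1 P0 = mixture t (mixture b P1 P0) (mixture a P1 P0).
Proof.
move=> lE; apply: probability_eq => A; rewrite !mixtureE.
have ge0N (s : {i01 R}) : 0 <= 1 - s%:num by rewrite subr_ge0.
have ge0 (s : {i01 R}) : 0 <= s%:num by [].
rewrite !ge0_muleDr ?mule_ge0 ?lee_fin//.
rewrite !muleA -!EFinM addeACA -!ge0_muleDl ?lee_fin ?mulr_ge0//.
by rewrite -!EFinD lE; congr (_ * _ + _%:E * _)%E; ring.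
Qed.

(** A point of a segment between two other ones is a mixture of these: this is
    what lets properties of whole segments be applied to their subsegments. *)
Lemma mixture_between a b l P1 P0 :
  a%:num <= l%:num -> l%:num <= b%:num -> a%:num < b%:num ->
  exists t, mixture l P1 P0 = mixture t (mixture b P1 P0) (mixture a P1 P0).
Proof.
move=> al lb ab; have ba0 : 0 < b%:num - a%:num by rewrite subr_gt0.
exists (clamp ((l%:num - a%:num) / (b%:num - a%:num))).
apply: mixture_of_mixtures; rewrite clampE; last first.
  by rewrite divr_ge0 ?(ltW ba0) ?subr_ge0//= ler_pdivrMr// mul1r lerD2r.
by field; rewrite gt_eqF.
Qed.

Lemma integral_mixture l P1 P0 (f : Y -> \bar R) :
  P1.-integrable setT f -> P0.-integrable setT f ->
  (\int[mixture l P1 P0]_y f y =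
   l%:num%:E * \int[P1]_y f y + (1 - l%:num)%:E * \int[P0]_y f y)%E.
Proof.
move=> f1 f0.
have mf := measurable_int _ f1.
have ge0_mix (g : Y -> \bar R) : measurable_fun setT g ->
    (forall y, 0 <= g y)%E ->
    (\int[mixture l P1 P0]_y g y =
     l%:num%:E * \int[P1]_y g y + (1 - l%:num)%:E * \int[P0]_y g y)%E.
  move=> mg g0.
  by rewrite [LHS]ge0_integral_measure_add// !ge0_integral_mscale.
rewrite (integralE _ _ f) (integralE P1 _ f) (integralE P0 _ f).
rewrite (ge0_mix f^\+%E) ?(ge0_mix f^\-%E)//;
  [|exact: measurable_funeneg|exact: measurable_funepos].
have := integrable_pos_fin_num measurableT f1.
have := integrable_pos_fin_num measurableT f0.
have := integrable_neg_fin_num measurableT f1.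
have := integrable_neg_fin_num measurableT f0.
do 4 move=> /fineK <-.
rewrite -!(EFinM, EFinD, EFinN); congr EFin; ring.
Qed.

End mixture_theory.

(** * Convex level sets *)

Section level_sets.
Context {dY} {Y : measurableType dY} {R : realType}.
Variable F : set (probability Y R).
Hypothesis convexF : convex_class F.
Implicit Types (P Q : probability Y R) (l t : {i01 R}).

Definition level_convex (V : Type) (T : probability Y R -> V) :=
  forall P0 P1 l, F P0 -> F P1 -> T P0 = T P1 -> T (mixture l P1 P0) = T P0.

Lemma expected_score_mixture (V : Type) (A : set V) (S : V -> Y -> R) x l
    P1 P0 :
  scoring_function F A S -> A x -> F P1 -> F P0 ->
  expected_score S x (mixture l P1 P0) =
  l%:num * expected_score S x P1 + (1 - l%:num) * expected_score S x P0.
Proof.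
move=> sS Ax F1 F0; have [_ iS] := sS _ Ax.
rewrite /expected_score /Rintegral integral_mixture ?iS//.
have := integrable_fin_num measurableT (iS _ F1).
have := integrable_fin_num measurableT (iS _ F0).
by do 2 move=> /fineK <-.
Qed.

(** If [T P0 = T P1], this common value minimizes the expected score under both
    [P0] and [P1], hence under their mixture, and minimizers are unique. *)
Lemma elicitable_level_convex (V : Type) (T : probability Y R -> V) :
  elicitable F T -> level_convex T.
Proof.
move=> [A [TA [S [sS cS]]]] P0 P1 l F0 F1 T01.
have FM := convexF l F0 F1.
have [AM A0] := (TA _ FM, TA _ F0).
have [le0 eq0] := cS _ _ A0 FM.
apply/esym/eq0/le_anti/andP; split; last exact: le0.
rewrite !(expected_score_mixture _ sS)//.
apply: lerD; apply: ler_wpM2l => //.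
  by rewrite T01; exact: (cS _ _ AM F1).1.
exact: (cS _ _ AM F0).1.
Qed.

Lemma segment_continuous (V : topologicalType) (T : probability Y R -> V)
    P1 P0 :
  mixture_continuous F T -> F P0 -> F P1 ->
  continuous (fun r : R => T (mixture (clamp r) P1 P0)).
Proof.
move=> cT F0 F1 r.
apply: (@continuous_comp _ (@unit_interval R) _ clamp
  (fun l => T (mixture l P1 P0))); first exact: clamp_continuous.
by apply: cT => // l; exact: convexF.
Qed.

Section real_valued.
Variable g : probability Y R -> R.
Hypotheses (cg : mixture_continuous F g) (lg : level_convex g).

Lemma mixture_ivt (a b : {i01 R}) P1 P0 v : F P0 -> F P1 ->
  a%:num <= b%:num ->
  Num.min (g (mixture a P1 P0)) (g (mixture b P1 P0)) <= v <=
  Num.max (g (mixture a P1 P0)) (g (mixture b P1 P0)) ->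
  exists2 l, a%:num <= l%:num <= b%:num & g (mixture l P1 P0) = v.
Proof.
move=> F0 F1 ab gv.
have ck (s : {i01 R}) : clamp s%:num = s.
  by apply/val_inj/clampE; rewrite !(ge0, le1).
have [||r] := @IVT R (fun r => g (mixture (clamp r) P1 P0)) a%:num b%:num v ab.
- exact/continuous_subspaceT/segment_continuous.
- by rewrite !ck.
rewrite in_itv/= => abr <-; exists (clamp r) => //.
rewrite clampE//; case/andP: abr => ar rb.
by rewrite (le_trans _ ar)//= (le_trans rb).
Qed.

(** If the value at [l] were at most [v], some [w > v] would be attained on both
    sides of [l], and then at [l] itself by convexity of the level set. *)
Lemma mixture_gt l P1 P0 v : F P0 -> F P1 ->
  v < g P0 -> v < g P1 -> v < g (mixture l P1 P0).
Proof.
move=> F0 F1 v0 v1; rewrite ltNge; apply/negP => gv.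
pose w := Num.min (g P0) (g P1).
have vw : v < w by rewrite lt_min v0.
have m0 := mixture_start P1 P0 clamp0.
have m1 := mixture_end P1 P0 clamp1.
have w0 : w <= g P0 by rewrite ge_min lexx.
have w1 : w <= g P1 by rewrite ge_min lexx orbT.
have [| |a /andP[_ al] ga] := @mixture_ivt (clamp 0) l P1 P0 w F0 F1.
- by rewrite clamp0.
- by rewrite m0 ge_min le_max w0 (le_trans gv (ltW vw)) orbT.
have [| |b /andP[lb _] gb] := @mixture_ivt l (clamp 1) P1 P0 w F0 F1.
- by rewrite clamp1.
- by rewrite m1 ge_min le_max w1 (le_trans gv (ltW vw)) orbT.
move: (le_trans al lb); rewrite le_eqVlt => /orP[/eqP ab|ab].
  have la : l = a by apply/val_inj/le_anti/andP; split => //=; rewrite ab.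
  by move: gv; rewrite la ga leNgt vw.
have [t lE] := mixture_between P1 P0 al lb ab.
move: gv; rewrite lE lg ?ga ?gb ?leNgt ?vw//; exact: convexF.
Qed.

End real_valued.

Lemma mixture_lt (g : probability Y R -> R) l P1 P0 v :
  mixture_continuous F g -> level_convex g -> F P0 -> F P1 ->
  g P0 < v -> g P1 < v -> g (mixture l P1 P0) < v.
Proof.
move=> cg lg F0 F1 v0 v1.
rewrite -ltrN2; apply: (@mixture_gt (fun P => - g P)) => //; rewrite ?ltrN2//.
  move=> Q0 Q1 FQ0 FQ1 FQ x.
  apply: (@continuousN R R^o (@unit_interval R)); exact: cg.
by move=> Q0 Q1 t FQ0 FQ1 /oppr_inj Q01; rewrite lg.
Qed.

(** The end points of the segment, which the defining equation of
    max-functionals leaves out, are mixtures equal to [P0] and [P1]. *)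
Lemma max_functional_mixture_ge (T : probability Y R -> R) l P1 P0 c :
  max_functional F T -> F P0 -> F P1 -> c <= T P0 -> c <= T P1 ->
  c <= T (mixture l P1 P0).
Proof.
move=> maxT F0 F1 c0 c1.
have [l0|l0] := eqVneq l%:num 0; first by rewrite mixture_start.
have [l1|l1] := eqVneq l%:num 1; first by rewrite mixture_end.
by rewrite maxT ?le_max ?c0// !lt_neqAle eq_sym l0 l1 ge0 le1.
Qed.

(** * Interior points of the range *)

Section interior_values.
Context {k : nat} {T' : probability Y R -> 'rV[R]_k}.
Hypotheses (cT' : mixture_continuous F T') (eT' : elicitable_components F T').

Lemma coordinate_mixture_continuous j :
  mixture_continuous F (fun P => T' P ord0 j).
Proof.
move=> P0 P1 F0 F1 FM l.
apply: (@continuous_comp (@unit_interval R) _ _ (fun l => T' (mixture l P1 P0))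
  (fun M : 'rV[R]_k => M ord0 j)); first exact: cT'.
exact: coord_continuous.
Qed.

Lemma small_mixture_close P Q e : F Q -> F P -> 0 < e ->
  exists2 l : {i01 R}, 0 < l%:num < 1 & ball (T' Q) e (T' (mixture l P Q)).
Proof.
move=> FQ FP e0; have := segment_continuous cT' FQ FP (x := 0).
rewrite /continuous_at (mixture_start _ _ clamp0).
move=> /cvg_ball/(_ _ e0) near0.
near (0 : R)^'+ => r.
have r01 : 0 < r < 1.
  apply/andP; split; near: r; first exact: nbhs_right_gt.
  exact: nbhs_right_lt ltr01.
exists (clamp r); last by near: r; apply: cvg_within; exact: near0.
by rewrite clampE//; case/andP: r01 => /ltW -> /ltW ->.
Unshelve. all: by end_near. Qed.

Definition same_side (s : bool) (x y : R) := if s then x < y else y < x.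

Lemma same_side_mixture s j l P1 P0 v : F P0 -> F P1 ->
  same_side s v (T' P0 ord0 j) -> same_side s v (T' P1 ord0 j) ->
  same_side s v (T' (mixture l P1 P0) ord0 j).
Proof.
move=> F0 F1; have cj := @coordinate_mixture_continuous j.
have lj := elicitable_level_convex (eT' j).
case: s => /= v0 v1.
  exact: (mixture_gt cj lj).
exact: (mixture_lt _ cj lj).
Qed.

(** For [n = k], the statement proved by induction on [n] below yields a
    distribution with value [x]; it has to be proved for all sign vectors [s] at
    once, since the step merges the distributions obtained for two of them. *)
Lemma max_functional_le_interior_value (T : probability Y R -> R) P x :
  max_functional F T -> F P -> (T' @` F)° x ->
  exists2 Q, F Q & T' Q = x /\ T P <= T Q.
Proof.
move=> maxT FP /nbhs_ballP[e /= e0 xe].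
(* Half the radius, so that the cube with these corners lies in the ball, which
   is open; it is also the margin left for the perturbation by [P]. *)
pose corner (s : 'I_k -> bool) : 'rV[R]_k :=
  \row_j (x ord0 j + (if s j then 1 else -1) * (e / 2)).
suff fix_coords n : (n <= k)%N -> forall s : 'I_k -> bool, exists M,
    [/\ F M, T P <= T M & forall j : 'I_k,
      if (j < n)%N then T' M ord0 j = x ord0 j
      else same_side (s j) (x ord0 j) (T' M ord0 j)].
  have [M [FM TM T'M]] := fix_coords k (leqnn k) (fun=> true).
  exists M => //; split=> //; apply/rowP => j.
  by have := T'M j; rewrite ltn_ord.
elim: n => [_ s|n IHn nk s].
  have [Q FQ T'Q] : (T' @` F) (corner s).
    apply: xe; split=> // i j; rewrite /ball/= !ord1 mxE opprD addNKr.
    rewrite normrN normrM.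
    rewrite (_ : `|_| = 1) ?mul1r; last by case: (s j); rewrite ?normrN normr1.
    by rewrite gtr0_norm ?divr_gt0// ltr_pdivrMr// ltr_pMr// ltr1n.
  have [l l01 bl] := small_mixture_close FQ FP (divr_gt0 e0 (ltr0Sn R 1)).
  exists (mixture l P Q); split; first exact: convexF.
    by rewrite maxT// le_max lexx orbT.
  move=> j; rewrite ltn0; have [_ /(_ ord0 j)] := bl.
  rewrite T'Q /ball/= mxE distrC ltr_norml.
  rewrite /same_side; case: (s j) => /andP[]; lra.
pose set_n b := fun j : 'I_k => if (j : nat) == n then b else s j.
have [M0 [FM0 TM0 T'M0]] := IHn (ltnW nk) (set_n false).
have [M1 [FM1 TM1 T'M1]] := IHn (ltnW nk) (set_n true).
pose jn := Ordinal nk.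
have := T'M0 jn; have := T'M1 jn.
rewrite /= ltnn /set_n/= eqxx /same_side => lt1 lt0.
have [| |l _ T'l] := @mixture_ivt (fun P => T' P ord0 jn)
  (@coordinate_mixture_continuous jn) (clamp 0) (clamp 1)
  M1 M0 (x ord0 jn) FM0 FM1.
- by rewrite clamp0 clamp1.
- rewrite (mixture_start _ _ clamp0) (mixture_end _ _ clamp1).
  by rewrite ge_min le_max (ltW lt0) (ltW lt1) orbT.
exists (mixture l M1 M0); split; first exact: convexF.
  exact: max_functional_mixture_ge.
move=> j; rewrite ltnS leq_eqVlt; have [jE|jn'] := eqVneq (j : nat) n.
  by rewrite (_ : j = jn) //; exact/val_inj.
have := T'M0 j; have := T'M1 j; rewrite /= /set_n (negPf jn').
case: ifP => _ => [eq1 eq0|]; last by move=> *; exact: same_side_mixture.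
by rewrite (elicitable_level_convex (eT' j)) ?eq0.
Qed.

End interior_values.
End level_sets.

(** * Elicitation complexity *)

Lemma elicitation_complexity_pinfty dY (Y : measurableType dY) (R : realType)
    (F : set (probability Y R))
    (C : forall k, set (probability Y R -> 'rV[R]_k))
    (T : probability Y R -> R) :
  (forall k, ~ linked F T (C k)) -> elicitation_complexity F C T = +oo%E.
Proof.
move=> nC; rewrite /elicitation_complexity; case: pselect => // exk.
by exfalso; case: exk => k /asboolP /nC.
Qed.

Theorem theorem3p7 (R : realType) (d : nat) (O : set 'rV[R]_d)
    (neO : O !=set0) (F : set (probability (borel_domain neO) R))
    (T : probability (borel_domain neO) R -> R)
    (convexF : convex_class F) (maxT : max_functional F T) :
  (~ (has_sup (T @` F) /\ (T @` F) (sup (T @` F))) ->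
     elicitation_complexity F (interior_class F) T = +oo%E) /\
  (~ (exists c : R, forall P, F P -> T P = c) ->
     elicitation_complexity F (open_class F) T = +oo%E).
Proof.
split=> notT; apply: elicitation_complexity_pinfty => k.
  move=> [T' [[_ cT' eT' [x x_int]] [f TE]]]; apply: notT.
  have [Q FQ T'Q] := interior_subset x_int.
  have ubTQ : ubound (T @` F) (T Q).
    move=> _ [P FP <-].
    have [M FM [T'M leTM]] :=
      max_functional_le_interior_value convexF cT' eT' maxT FP x_int.
    by rewrite (TE _ FQ) T'Q -T'M -TE.
  have TFQ : (T @` F) (T Q) by exists Q.
  have hs : has_sup (T @` F) by split; exists (T Q).
  split=> //; suff -> : sup (T @` F) = T Q by [].
  apply/le_anti; rewrite ub_le_sup ?andbT//; last by case: hs.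
  by apply: ge_sup => //; case: hs.
move=> [T' [[_ cT' eT' oT'] [f TE]]]; apply: notT.
have leT P Q : F P -> F Q -> T P <= T Q.
  move=> FP FQ.
  have x_int : (T' @` F)° (T' Q).
    by rewrite (iffLR (interior_id _) oT'); exists Q.
  have [M FM [T'M leTM]] :=
      max_functional_le_interior_value convexF cT' eT' maxT FP x_int.
  by rewrite (TE _ FQ) -T'M -TE.
have [[P FP]|F0] := pselect (F !=set0).
  by exists (T P) => Q FQ; apply/le_anti; rewrite !leT.
by exists 0 => P FP; case: F0; exists P.
Qed.
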